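(* There exists a perfect set $P\subseteq\mathbb{R}^\omega$ (nonempty, closed, without isolated points) which is a maximal orthogonal family in $\mathbb{R}^\omega$.
   Context: $\omega=\{0,1,2,\dots\}$ and $\mathbb{R}^\omega$ is the set of all real sequences with the product topology. For $x,y\in\mathbb{R}^\omega$ the inner product is $(x,y)=\sum_{n\in\omega}x(n)y(n)$, which need not be finite or exist; $x$ and $y$ are orthogonal if the series $(x,y)$ converges (as the limit of its partial sums) and equals $0$. A family $F\subseteq\mathbb{R}^\omega\setminus\{\mathbf{0}\}$ of pairwise orthogonal sequences is a maximal orthogonal family iff the only element of $\mathbb{R}^\omega$ orthogonal to every element of $F$ is $\mathbf{0}$, the constant $0$ sequence. *)

(* Defs.v *)
From HB Require Import structures.
From mathcomp Require Import all_boot all_order all_algebra.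
From mathcomp Require Import all_classical all_reals all_analysis.

Set Implicit Arguments.
Unset Strict Implicit.
Unset Printing Implicit Defensive.

Import Order.TTheory GRing.Theory Num.Theory.
Import numFieldNormedType.Exports.

Local Open Scope classical_set_scope.
Local Open Scope ring_scope.

(* [{ptws nat -> R}] is [nat -> R] carrying the product topology. *)
Definition realseq (R : realType) : topologicalType := {ptws nat -> R}.

(* The partial sums must tend to 0; absolute convergence is not required. *)
Definition orthogonal_seq (R : realType) (x y : nat -> R) : Prop :=
  series (fun n => x n * y n) @ \oo --> (0 : R).

Definition orthogonal_family (R : realType) (F : set (nat -> R)) : Prop :=
  (forall x, F x -> x <> (fun=> 0)) /\
  (forall x y, F x -> F y -> x <> y -> orthogonal_seq x y).

Definition maximal_orthogonal_family (R : realType) (F : set (nat -> R)) : Prop :=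
  orthogonal_family F /\
  (forall z : nat -> R, (forall x, F x -> orthogonal_seq z x) -> z = (fun=> 0)).

(* Main.v *)
Require Import Defs.
From HB Require Import structures.
From mathcomp Require Import all_boot all_order all_algebra.
From mathcomp Require Import all_classical all_reals all_analysis.
From mathcomp Require Import lra zify.

Set Implicit Arguments.
Unset Strict Implicit.
Unset Printing Implicit Defensive.

Import Order.TTheory GRing.Theory Num.Theory.
Import numFieldNormedType.Exports.

Local Open Scope classical_set_scope.
Local Open Scope ring_scope.

(** The family has one member for each branch of the binary tree.  Index the
    coordinates by the tree: coordinate 0 stands apart, and coordinates 1, 2,
    ... are the nodes in breadth-first order, the children of n being 2n and
    2n+1.  The vector [branch_vec f] of a branch f has coordinate 0 equal to 1
    and is supported, besides, on the nodes of f.  At a node s of f it is 1 if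
    f turns left there and -C if f turns right, where C = [energy s] is the sum
    of the squares of all its earlier coordinates.

    Orthogonality ([branch_vec_orthogonal]).  Two branches f and g that part at
    s have equal vectors before s and disjoint supports after s.  So their inner
    product is a finite sum: C for the coordinates before s, and 1 * (-C) at s.

    Maximality ([branch_vec_maximal]).  For a sequence z, the partial sums of
    (z, branch_vec f) are the values along f of a function h on the nodes
    ([potential]), whose two values below s are h(s) + z(s) and h(s) - C z(s).
    Since C > 0, h(s) lies between them, so h^2 does not decrease towards at
    least one child (a maximum principle).  If h(s) were nonzero, moving to such
    a child again and again would give a branch along which h does not tend to
    0, that is, a member not orthogonal to z.  Hence h = 0 and z = 0.

    Perfectness ([perfect_range_vec]).  Each coordinate of [branch_vec f]
    depends on finitely many turns of f, so f |-> branch_vec f is a continuous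
    injection of the Cantor space; its image is compact and inherits the absence
    of isolated points. *)

(** * Finite paths and branches of the binary tree *)

(** A finite path is listed with its latest turn first, so that going to a
    child is a [cons] and functions of nodes are defined by recursion on the
    list. *)
Fixpoint branch (f : nat -> bool) (k : nat) : seq bool :=
  if k is k'.+1 then f k' :: branch f k' else [::].

Lemma size_branch f k : size (branch f k) = k.
Proof. by elim: k => //= k ->. Qed.

Lemma eq_branch f g k : (forall i, (i < k)%N -> f i = g i) ->
  branch f k = branch g k.
Proof.
elim: k => //= k IH fg; rewrite fg // IH // => i ik.
by apply: fg; exact: ltnW.
Qed.

Lemma branch_inj_at f g i k : (i < k)%N -> branch f k = branch g k -> f i = g i.
Proof.
elim: k => //= k IH; rewrite ltnS leq_eqVlt => /predU1P[-> [] //|ik [_]].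
exact: IH.
Qed.

Lemma branch_through s : exists f, branch f (size s) = s.
Proof.
exists (fun i => nth false (rev s) i).
elim: s => //= b s IH; congr (_ :: _).
  by rewrite rev_cons nth_rcons size_rev ltnn eqxx.
rewrite -[RHS]IH; apply: eq_branch => i is_.
by rewrite rev_cons nth_rcons size_rev is_.
Qed.

(** A branch may be specified by a rule choosing each turn from the path that
    precedes it; this builds the branch that refutes orthogonality in
    [potential_eq0]. *)
Lemma branch_of_strategy (c : seq bool -> bool) :
  exists f, forall k, f k = c (branch f k).
Proof.
pose grow := fix grow k := if k is k'.+1 then c (grow k') :: grow k' else [::].
exists (fun k => c (grow k)) => k; congr c.
by elim: k => //= k <-.
Qed.

Lemma branch_splits (f g : nat -> bool) : f <> g ->
  exists k, branch f k = branch g k /\ f k != g k.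
Proof.
move=> fg; have ex : exists k, f k != g k.
  apply: contra_notP fg => /forallNP E; apply/funext => k.
  exact/eqP/negPn/negP.
case: (ex_minnP ex) => k fgk kmin; exists k; split=> //.
apply: eq_branch => i; apply: contraTeq => /kmin.
by rewrite leqNgt.
Qed.

(** * Numbering of the nodes *)

(** Breadth-first numbering with root 1: the paths of length k fill the block
    of integers from 2^k to 2^(k+1) - 1, so ancestors precede descendants. *)
Fixpoint node (s : seq bool) : nat :=
  if s is b :: s' then b + (node s').*2 else 1.

Lemma node_bounds s : (2 ^ size s <= node s < 2 ^ (size s).+1)%N.
Proof.
elim: s => //= b s; rewrite !expnS => /andP[lo hi].
by case: b; apply/andP; split; lia.
Qed.

Lemma node_inj s t : size s = size t -> node s = node t -> s = t.
Proof.
elim: s t => [|b s IH] [|c t] //= [st] e.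
have bc : b = c by have := congr1 odd e; rewrite !oddD !odd_double !addbF !oddb.
by rewrite bc in e *; rewrite (IH t) //; apply: double_inj; apply: (addnI e).
Qed.

Lemma node_surj n : (0 < n)%N -> exists s, node s = n.
Proof.
elim/ltn_ind: n => n IH n0.
have [n1|n1] := leqP n 1; first by exists [::]; rewrite /=; lia.
have [||s sE] := IH n./2; [lia|lia|].
by exists (odd n :: s); rewrite /= sE odd_double_half.
Qed.

(** * The vectors of the branches *)

Section branch_vectors.
Variable R : realType.
Implicit Types (s : seq bool) (f g : nat -> bool) (z : nat -> R).

(** The squared norm of the coordinates that a vector has met before the node
    s.  The squared term is the square of [entry b s'], unfolded because
    [entry] is defined from [energy]. *)
Fixpoint energy s : R :=
  if s is b :: s' then energy s' + (if b then - energy s' else 1) ^+ 2 else 1.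

Definition entry (b : bool) s : R := if b then - energy s else 1.

Lemma energy_gt0 s : 0 < energy s.
Proof. by elim: s => //= b s IH; rewrite ltr_wpDr ?sqr_ge0. Qed.

Lemma entry_inj b c s : entry b s = entry c s -> b = c.
Proof.
by case: b c => [] [] //=; have := energy_gt0 s; rewrite /entry; lra.
Qed.

(** The relation that cancels the inner product of two vectors whose branches
    part at s. *)
Lemma entryM b c s : b != c -> entry b s * entry c s = - energy s.
Proof. by case: b c => [] [] //=; rewrite /entry ?mulr1 ?mul1r. Qed.

(** A node n >= 1 lies at depth [trunc_log 2 n]; it can only lie on f as the
    node that f visits at this depth. *)
Definition branch_vec f (n : nat) : R :=
  if n == 0%N then 1 else
  let k := trunc_log 2 n in
  if n == node (branch f k) then entry (f k) (branch f k) else 0.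

Lemma branch_vec_block f n k : (2 ^ k <= n < 2 ^ k.+1)%N ->
  branch_vec f n =
    if n == node (branch f k) then entry (f k) (branch f k) else 0.
Proof.
move=> /[dup] /andP[lo _] nk; rewrite /branch_vec (trunc_log_eq _ nk) //.
by rewrite gtn_eqF // (leq_trans _ lo) ?expn_gt0.
Qed.

Lemma branch_block f k :
  (2 ^ k <= node (branch f k) < 2 ^ k.+1)%N.
Proof. by have := node_bounds (branch f k); rewrite size_branch. Qed.

Lemma branch_vec_node f k :
  branch_vec f (node (branch f k)) = entry (f k) (branch f k).
Proof. by rewrite (branch_vec_block _ (branch_block f k)) eqxx. Qed.

Lemma branch_vec_node_off f g k : branch f k <> branch g k ->
  branch_vec f (node (branch g k)) = 0.
Proof.
move=> fg; rewrite (branch_vec_block _ (branch_block g k)); case: eqP => //.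
by move=> /node_inj; rewrite !size_branch => /(_ erefl)/esym.
Qed.

(** The partial sum, up to the node s excluded, of the inner product of z with
    the vector of any branch through s. *)
Fixpoint potential z s : R :=
  if s is b :: s' then potential z s' + z (node s') * entry b s' else z 0%N.

(** Each block of indices from 2^k to 2^(k+1) - 1 contributes a single term,
    at the node where f has depth k. *)
Lemma series_vec z f k :
  series (fun n => z n * branch_vec f n) (2 ^ k)%N = potential z (branch f k).
Proof.
elim: k => [|k IH] /=.
  by rewrite /series /= big_nat1 /branch_vec eqxx mulr1.
have le2 : (2 ^ k <= 2 ^ k.+1)%N by rewrite leq_exp2l.
rewrite -IH /series /= (@big_cat_nat _ _ _ (2 ^ k)%N) //=; congr (_ + _).
have E : \sum_(2 ^ k <= n < 2 ^ k.+1 | n == node (branch f k))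
    z n * entry (f k) (branch f k) =
    z (node (branch f k)) * entry (f k) (branch f k).
  by rewrite big_nat1_eq branch_block.
rewrite -[RHS]E [RHS]big_mkcond; apply: eq_big_nat => n nk.
by rewrite (branch_vec_block _ nk); case: ifP; rewrite ?mulr0.
Qed.

(** Up to the level where they part, two vectors coincide, so that their inner
    product accumulates squares. *)
Lemma potential_shared f g k : branch f k = branch g k ->
  potential (branch_vec f) (branch g k) = energy (branch g k).
Proof.
elim: k => [_|k IH] /=; first by rewrite /branch_vec eqxx.
case=> fgk E; rewrite IH // -E branch_vec_node -fgk -expr2.
by case: (f k).
Qed.

Lemma branch_vec_orthogonal f g : f <> g ->
  orthogonal_seq (branch_vec f) (branch_vec g).
Proof.
move=> /branch_splits[k [E fgk]].
have split_later j : (k < j)%N -> branch f j <> branch g j.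
  by move=> kj /(branch_inj_at kj) /eqP; apply/negP.
have sum0 : series (fun n => branch_vec f n * branch_vec g n) (2 ^ k.+1)%N = 0.
  rewrite series_vec /= potential_shared // -{2}E branch_vec_node E entryM //.
  by rewrite subrr.
apply: cvg_near_cst; exists (2 ^ k.+1)%N => // n /= kn.
rewrite -[RHS]sum0 /series /= (@big_cat_nat _ _ _ (2 ^ k.+1)%N) //=.
rewrite [X in _ + X]big_nat_cond [X in _ + X]big1 ?addr0 // => i.
rewrite andbT => /andP[ki _]; have i0 : (0 < i)%N.
  by rewrite (leq_trans _ ki) ?expn_gt0.
have blk := trunc_log_bounds (isT : (1 < 2)%N) i0.
set j := trunc_log 2 i in blk.
have kj : (k < j)%N by rewrite /j trunc_log_max.
rewrite [branch_vec g i](branch_vec_block _ blk).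
case: eqP => [->|_]; last by rewrite mulr0.
by rewrite branch_vec_node_off ?mul0r //; exact: split_later.
Qed.

Lemma branch_vec_inj : injective branch_vec.
Proof.
move=> f g fg; apply: contrapT => /branch_splits[k [E /eqP]]; apply.
by apply: (@entry_inj _ _ (branch g k)); rewrite -{1}E -!branch_vec_node fg E.
Qed.

(** The maximum principle, with h = [potential z]: one of the two possible
    entries at s is positive and the other negative, so one of the increments
    z(s) * [entry b s] does not have the sign opposite to that of h(s); turning
    in that direction keeps h^2 from decreasing. *)
Lemma potential_eq0 z :
  (forall f, potential z (branch f k) @[k --> \oo] --> (0 : R)) ->
  forall s, potential z s = 0.
Proof.
move=> z0 s; apply: contrapT => /eqP hs.
have [f fs] := branch_through s.
(* Turn right exactly when the increment of the left turn, which is z(node t),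
   has the sign opposite to that of h(t). *)
pose right t := potential z t * z (node t) < 0.
(* Up to depth [size s] the rule steers the branch to s. *)
have [g gE] := branch_of_strategy
  (fun t => if (size t < size s)%N then f (size t) else right t).
have gs : branch g (size s) = s.
  rewrite -[RHS]fs; apply: eq_branch => i is_.
  by rewrite gE size_branch is_.
have up k : potential z s ^+ 2 <= potential z (branch g (k + size s)) ^+ 2.
  elim: k => [|k IH]; first by rewrite gs.
  apply: (le_trans IH); rewrite /= gE size_branch ltnNge leq_addl /=.
  set t := branch g _; have C0 := energy_gt0 t.
  rewrite /entry /right; case: ltP => hz.
    rewrite sqrrD -addrA lerDl addr_ge0 ?sqr_ge0 // mulrA mulrN mulrn_wge0 //.
    by rewrite -mulNr mulr_ge0 ?ltW // oppr_gt0.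
  by rewrite mulr1 sqrrD -addrA lerDl addr_ge0 ?sqr_ge0 // mulrn_wge0.
have hs2 : 0 * 0 < potential z s ^+ 2 by rewrite mul0r exprn_even_gt0.
have := cvgr_lt _ (cvgM (z0 g) (z0 g)) _ hs2.
move=> [N _ /(_ (N + size s)%N)] /=; rewrite leq_addr => /(_ isT).
by rewrite ltNge -expr2 up.
Qed.

(** Only the partial sums at the indices 2^k enter: they already force
    h = [potential z] to vanish, and z at a node is an increment of h. *)
Lemma branch_vec_maximal z :
  (forall f, orthogonal_seq z (branch_vec f)) -> z = (fun=> 0).
Proof.
move=> zf; have h0 : forall s, potential z s = 0.
  apply: potential_eq0 => f.
  rewrite -(_ : series (fun n => z n * branch_vec f n) \o expn 2 =
     (fun k => potential z (branch f k))); last first.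
    by apply/funext => k; rewrite /= series_vec.
  apply: cvg_comp (zf f).
  move=> A [N _ NA]; exists N => // k /= Nk; apply: NA => /=.
  by rewrite (leq_trans Nk) // ltnW // ltn_expl.
apply/funext => -[|n]; first exact: (h0 [::]).
have [s <-] := node_surj (ltn0Sn n).
by have := h0 (false :: s); rewrite /= h0 add0r /entry mulr1.
Qed.

(** * Topology of the family *)

Lemma near_branch (f : cantor_space) k :
  \forall g \near f, branch g k = branch f k.
Proof.
elim: k => [|k IH]; first by apply: filterE.
have fk : \forall g \near f, g k = f k.
  apply: (@proj_continuous _ (fun=> bool) k f [set f k]).
  exact: discrete_set1.
by near=> g => /=; congr (_ :: _); near: g.
Unshelve. all: by end_near. Qed.

Lemma branch_vec_continuous :
  continuous (branch_vec : cantor_space -> realseq R).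
Proof.
move=> f; apply/(@pointwise_cvgP nat R) => n.
apply: (@cvg_near_cst _ _ _ (fun g : cantor_space => branch_vec g n) (nbhs f)).
near=> g.
have /= [gk gb] : branch g (trunc_log 2 n).+1 = branch f (trunc_log 2 n).+1.
  by near: g; exact: near_branch.
by rewrite /branch_vec gk gb.
Unshelve. all: by end_near. Qed.

Lemma perfect_range_vec :
  perfect_set (range (branch_vec : cantor_space -> realseq R)).
Proof.
have cl : closed (range (branch_vec : cantor_space -> realseq R)).
  apply: compact_closed.
    by apply: hausdorff_product => _; exact: Rhausdorff.
  apply: continuous_compact cantor_space_compact.
  exact: continuous_subspaceT branch_vec_continuous.
split=> //; rewrite eqEsubset; split=> [y yl|_ [f _ <-]].
  by apply: cl => U /yl[x [_ xP Ux]]; exists x.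
(* A neighbourhood of a member pulls back to a neighbourhood of its branch,
   which contains another branch. *)
move=> U /branch_vec_continuous fU.
have : limit_point [set: cantor_space] f by rewrite cantor_perfect.2.
move=> /(_ _ fU)[g [gf _ Ug]]; exists (branch_vec g); split=> //.
by apply: contra_neq gf => /branch_vec_inj.
Qed.

End branch_vectors.

Theorem theorem2 (R : realType) :
  exists P : set (realseq R),
    [/\ P !=set0, perfect_set P & maximal_orthogonal_family P].
Proof.
exists (range (@branch_vec R : cantor_space -> realseq R)); split.
- by exists (branch_vec R (fun=> true)), (fun=> true).
- exact: perfect_range_vec.
split; [split|].
- move=> _ [f _ <-] /(congr1 (@^~ 0%N)) /eqP.
  by rewrite /branch_vec eqxx oner_eq0.
- move=> _ _ [f _ <-] [g _ <-] fg.
  by apply: branch_vec_orthogonal => E; apply: fg; rewrite E.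
- by move=> z zP; apply: branch_vec_maximal => f; apply: zP; exists f.
Qed.
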